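(* Let $\ell\in\mathbb{N}\cup\{0\}$. For integers $m\ge0$ and $N\ge1$, let $L_\ell(m,N)$ be the number of partitions of $N$ into $m$ parts whose largest part, say $n$, appears at least $n+\ell$ times, and let $R_\ell(k,N)$ be the number of generalized Rogers--Ramanujan partitions of $N$ associated with $\ell$ having rank $k$. Then $L_\ell(m,N)=R_\ell(m-1,N)$.
   Context: A generalized Rogers--Ramanujan partition of $N$ associated with $\ell$ is a partition of $N$ into parts all greater than $\ell$ in which any two parts differ by at least $2$. The rank of a partition is its largest part minus its number of parts. *)

(* Defs.v *)
From HB Require Import structures.
From mathcomp Require Import all_boot all_order all_algebra.

Set Implicit Arguments.
Unset Strict Implicit.
Unset Printing Implicit Defensive.

Import GRing.Theory.

(* Partitions of N are nonincreasing sequences of positive integers. *)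
Definition is_intpart (N : nat) (p : seq nat) : bool :=
  [&& sorted geq p, all (leq 1) p & sumn p == N].

Record intpart (N : nat) := IntPart {
  parts :> seq nat;
  _ : is_intpart N parts }.

HB.instance Definition _ (N : nat) := [isSub of intpart N for @parts N].
HB.instance Definition _ (N : nat) := [Countable of intpart N by <:].

(* A partition of N has at most N parts, each at most N; this embeds intpart N
   into a finite type, which is used only to obtain its finType structure. *)
Lemma intpart_bound (N : nat) (p : intpart N) :
  (size p <= N) && all (fun i => i <= N) p.
Proof.
case: p => p /= /and3P[_ ppos /eqP <-].
elim: p ppos => //= x p IH /andP[x0 /IH /andP[sp ap]].
rewrite -[(size p).+1]add1n leq_add //= leq_addr /=.
by apply: sub_all ap => i /leq_trans; apply; rewrite leq_addl.
Qed.

Definition intpart_code (N : nat) (p : intpart N) : N.-bseq 'I_N.+1 :=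
  insub_bseq N (map inord p).

Definition intpart_decode (N : nat) (s : N.-bseq 'I_N.+1) : option (intpart N) :=
  insub (map (@nat_of_ord N.+1) s).

Lemma intpart_codeK (N : nat) : pcancel (@intpart_code N) (@intpart_decode N).
Proof.
move=> p; have /andP[sp ap] := intpart_bound p.
rewrite /intpart_decode /intpart_code /insub_bseq insubdK ?size_map //; last first.
  by rewrite -topredE /= size_map.
rewrite -map_comp (_ : map _ _ = p) ?valK //.
rewrite -[RHS]map_id; apply/eq_in_map => i /(allP ap) iN /=.
by rewrite inordK.
Qed.

HB.instance Definition _ (N : nat) :=
  isFinite.Build (intpart N) (pcan_enumP (@intpart_codeK N)).

Definition largest_part (p : seq nat) : nat := \max_(i <- p) i.

Definition part_rank (p : seq nat) : int :=
  ((largest_part p)%:Z - (size p)%:Z)%R.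

(* Pairs are taken over distinct positions, so repeated parts are excluded. *)
Definition gen_Rogers_Ramanujan (l : nat) (p : seq nat) : bool :=
  all (fun i => l < i) p && pairwise (fun i j : nat => 2 <= `|i - j|)%N p.

Definition num_L (l m N : nat) : nat :=
  #|[set p : intpart N | (size p == m) &&
      (largest_part p + l <= count_mem (largest_part p) p)]|.

Definition num_R (l : nat) (k : int) (N : nat) : nat :=
  #|[set p : intpart N | gen_Rogers_Ramanujan l p && (part_rank p == k)]|.

(* Main.v *)
Require Import Defs.
From mathcomp Require Import all_boot all_order all_algebra.
From mathcomp Require Import zify.

Set Implicit Arguments.
Unset Strict Implicit.

(** Let [p'] be the conjugate of [p], and let [n] be the largest part of [p],
    i.e. the number of parts of [p']. That [n] appears at least [n + l] times in
    [p] means that the smallest part of [p'] is at least [n + l], and [p'] has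
    largest part [m]. Adding the centred staircase [n - 1, n - 3, ..., 1 - n] to
    [p'] preserves the sum, makes consecutive gaps at least 2, lowers the
    smallest part by [n - 1] to at least [l + 1], and raises the largest part to
    [m + n - 1], so that the rank becomes [m - 1]. *)

(** A left inverse [g] makes [f] injective on [P]. Used once in each direction, this turns a
    bijection given on bare sequences into an equality of cardinals. *)
Lemma leq_card_intpart (N : nat) (P Q : pred (seq nat)) (f g : seq nat -> seq nat) :
    (forall p, is_intpart N p -> P p ->
       [/\ is_intpart N (f p), Q (f p) & g (f p) = p]) ->
  #|[set p : intpart N | P p]| <= #|[set p : intpart N | Q p]|.
Proof.
move=> fP; pose F (p : intpart N) := insubd p (f p).
have valF (p : intpart N) : P p -> val (F p) = f p.
  by move=> Pp; rewrite insubdK //; case: (fP _ (valP p) Pp).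
rewrite -(@card_in_imset _ _ F) => [|p q].
  apply/subset_leq_card/subsetP => _ /imsetP[p + ->]; rewrite !inE => Pp.
  by rewrite -[parts _]/(val _) valF //; case: (fP _ (valP p) Pp).
rewrite !inE => Pp Pq /(congr1 val); rewrite !valF // => /(congr1 g) eq_pq.
apply: val_inj; case: (fP _ (valP p) Pp) => _ _ <-.
by case: (fP _ (valP q) Pq) => _ _ <-.
Qed.

Lemma intpart_size_gt0 N p : 0 < N -> is_intpart N p -> 0 < size p.
Proof. by case: p => // N0 /and3P[_ _ /eqP N0']; rewrite -N0' in N0. Qed.

Lemma sorted_geq_all x p : sorted geq (x :: p) -> all (geq x) p.
Proof. by apply: order_path_min => i j k ij jk; apply: leq_trans jk ij. Qed.

Lemma largest_part_head p : sorted geq p -> largest_part p = head 0 p.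
Proof.
case: p => [_|x p /sorted_geq_all/allP px]; rewrite /largest_part ?big_nil //.
rewrite big_cons big_seq; apply/maxn_idPl.
by elim/big_ind: _ => [|a b ax bx|i /px] //; rewrite geq_max ax.
Qed.

Lemma sorted_geq_nth p i j : sorted geq p -> i <= j -> nth 0 p j <= nth 0 p i.
Proof.
move=> sp ij; have [jp|/(nth_default 0)-> //] := ltnP j (size p).
have geq_trans : transitive geq by move=> a b c ab ac; apply: leq_trans ac ab.
by apply: (sorted_leq_nth geq_trans leqnn 0 sp); rewrite ?inE // (leq_ltn_trans ij).
Qed.

Lemma eq_mkseq_nth (p : seq nat) (f : nat -> nat) :
  (forall i, i < size p -> f i = nth 0 p i) -> mkseq f (size p) = p.
Proof.
move=> fp; apply: (@eq_from_nth _ 0); rewrite size_mkseq // => i ip.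
by rewrite nth_mkseq // fp.
Qed.

Lemma sumn_mkseq f n : sumn (mkseq f n) = \sum_(i < n) f i.
Proof. by rewrite sumnE big_map -(big_mkord xpredT f) /index_iota subn0. Qed.

Lemma sumn_nth (p : seq nat) : sumn p = \sum_(i < size p) nth 0 p i.
Proof. by rewrite -sumn_mkseq eq_mkseq_nth. Qed.

Definition conjugate (p : seq nat) : seq nat :=
  mkseq (fun i => count (ltn i) p) (head 0 p).

(** Both sides say that the cell in row [i] and column [j] lies in the Young diagram of [p]: the
    parts exceeding [j] form a prefix of [p]. *)
Lemma ltn_count p i j : sorted geq p -> (i < count (ltn j) p) = (j < nth 0 p i).
Proof.
elim: p i => [|x p IH] i sp; first by rewrite nth_nil.
have {}IH := IH^~ (path_sorted sp).
have [jx|xj] := ltnP j x; first by case: i => [|i] /=; rewrite jx //= add1n ltnS IH.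
have px : nth 0 (x :: p) i <= x := @sorted_geq_nth _ 0 _ sp (leq0n i).
rewrite [RHS]ltnNge (leq_trans px xj) /= (leq_gtF xj) add0n.
by apply/negbTE; rewrite IH -leqNgt (leq_trans (sorted_geq_nth sp (leq0n i.+1)) xj).
Qed.

Lemma count_gtn_iota k n : count (gtn k) (iota 0 n) = minn k n.
Proof.
elim: n => [|n IH]; first by rewrite minn0.
by rewrite -addn1 iotaD count_cat IH /=; lia.
Qed.

Lemma size_conjugate p : size (conjugate p) = head 0 p.
Proof. by rewrite size_mkseq. Qed.

Lemma nth_conjugate p i :
  sorted geq p -> nth 0 (conjugate p) i = count (ltn i) p.
Proof.
move=> sp; have [ip|ip] := ltnP i (head 0 p); first by rewrite nth_mkseq.
rewrite nth_default ?size_conjugate //; apply/esym/eqP.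
by rewrite -leqn0 leqNgt ltn_count // nth0 -leqNgt.
Qed.

Lemma head_conjugate p : sorted geq p -> all (leq 1) p -> head 0 (conjugate p) = size p.
Proof. by move=> sp p0; rewrite -nth0 nth_conjugate //; apply/eqP; rewrite -all_count. Qed.

Lemma conjugateK p : sorted geq p -> all (leq 1) p -> conjugate (conjugate p) = p.
Proof.
move=> sp p0; rewrite {1}/conjugate head_conjugate //.
apply: eq_mkseq_nth => j jp; rewrite count_map.
(* Column [i] is longer than [j] exactly when [i] is below part [j], so the columns counted are an
   initial segment. *)
rewrite (@eq_count _ _ (gtn (nth 0 p j))); last by move=> i /=; rewrite ltn_count.
by rewrite count_gtn_iota; apply/minn_idPl; rewrite -nth0; apply: sorted_geq_nth.
Qed.

(** Double counting: the cells of the diagram are summed by columns, then by rows. *)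
Lemma sumn_conjugate p : sorted geq p -> sumn (conjugate p) = sumn p.
Proof.
move=> sp; rewrite sumn_mkseq.
under eq_bigr do rewrite -sum1_count big_mkcond /=.
rewrite exchange_big /= sumnE big_seq [RHS]big_seq.
apply: eq_bigr => x /(nthP 0)[i _ <-].
rewrite -big_mkcond /= -(big_mkord (gtn (nth 0 p i)) (fun=> 1)) sum1_count.
rewrite /index_iota subn0 count_gtn_iota; apply/minn_idPl.
by rewrite -nth0; apply: sorted_geq_nth.
Qed.

Lemma conjugate_intpart N p : is_intpart N p -> is_intpart N (conjugate p).
Proof.
case/and3P=> sp p0 /eqP <-; rewrite /is_intpart sumn_conjugate // eqxx andbT.
apply/andP; split.
  apply/(sortedP 0) => i _; rewrite /= !nth_conjugate //.
  by apply: sub_count => x /=; apply: ltnW.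
apply/(all_nthP 0) => i; rewrite size_conjugate nth_conjugate // => ip.
by rewrite ltn_count // nth0.
Qed.

(** The condition counted by [num_L], read on the conjugate; in a nonincreasing sequence [head] and
    [last] are the largest and smallest parts. *)
Definition wide_conjugate (l m : nat) (p : seq nat) : bool :=
  (head 0 p == m) && (size p + l <= last 0 p).

Lemma wide_conjugateE N l m p : 0 < N -> is_intpart N p ->
  wide_conjugate l m (conjugate p) =
  (size p == m) && (largest_part p + l <= count_mem (largest_part p) p).
Proof.
move=> N0 pN; have /and3P[sp p0 _] := pN.
rewrite /wide_conjugate head_conjugate // size_conjugate largest_part_head //.
congr (_ && (_ <= _)).
have h0 : 0 < head 0 p.
  by have := intpart_size_gt0 N0 pN; case: (p) p0 => //= x s /andP[].
(* The last column counts the parts exceeding [(head 0 p).-1]; by maximality these are the parts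
   equal to [head 0 p]. *)
rewrite -nth_last size_conjugate nth_conjugate //.
apply: eq_in_count => x /(nthP 0)[i ip <-] /=.
by rewrite prednK // eqn_leq -(nth0 0) (sorted_geq_nth sp (leq0n i)).
Qed.

Lemma num_L_conjugate l m N : 0 < N ->
  num_L l m N = #|[set p : intpart N | wide_conjugate l m p]|.
Proof.
move=> N0; apply/eqP; rewrite eqn_leq; apply/andP; split.
  apply: (@leq_card_intpart N (fun p => (size p == m) &&
    (largest_part p + l <= count_mem (largest_part p) p)) _ conjugate conjugate).
  move=> p pN Lp; have /and3P[sp p0 _] := pN.
  by rewrite conjugate_intpart // (wide_conjugateE _ _ N0 pN) conjugateK.
apply: (@leq_card_intpart N _ (fun p => (size p == m) &&
  (largest_part p + l <= count_mem (largest_part p) p)) conjugate conjugate).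
move=> p pN Cp; have /and3P[sp p0 _] := pN; have cN := conjugate_intpart pN.
by rewrite cN -(wide_conjugateE _ _ N0 cN) conjugateK.
Qed.

(** The shift of entry [i] changes sign along the sequence, so the addition comes first; the
    truncated subtraction is exact once all entries are at least [size p]. *)
Definition add_staircase (p : seq nat) : seq nat :=
  mkseq (fun i => nth 0 p i + (size p).-1 - i.*2) (size p).

Definition sub_staircase (p : seq nat) : seq nat :=
  mkseq (fun i => nth 0 p i + i.*2 - (size p).-1) (size p).

Lemma sum_rev_ord n : \sum_(i < n) (n.-1 - i) = \sum_(i < n) i.
Proof.
rewrite [RHS](reindex_inj rev_ord_inj) /=; apply: eq_bigr => i _; lia.
Qed.

Lemma sumn_add_staircase p :
  (forall i, i < size p -> size p <= nth 0 p i) -> sumn (add_staircase p) = sumn p.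
Proof.
move=> ple; rewrite sumn_mkseq sumn_nth.
(* The staircase sums to zero: with the sum of all [i] added on both sides, and reversed on the
   right, the summands agree one by one. *)
apply/eqP; rewrite -(eqn_add2r (\sum_(i < size p) i)) -{2}sum_rev_ord -!big_split.
apply/eqP/eq_bigr => i _ /=; have := ple i (ltn_ord i); have := ltn_ord i; lia.
Qed.

Lemma add_staircaseK p :
    (forall i, i < size p -> size p <= nth 0 p i) ->
  sub_staircase (add_staircase p) = p.
Proof.
move=> ple; rewrite /sub_staircase size_mkseq; apply: eq_mkseq_nth => i ip.
by rewrite nth_mkseq //; have := ple i ip; lia.
Qed.

Lemma sub_staircaseK p :
    (forall i, i < size p -> (size p).-1 <= nth 0 p i + i.*2) ->
  add_staircase (sub_staircase p) = p.
Proof.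
move=> ple; rewrite /add_staircase size_mkseq; apply: eq_mkseq_nth => i ip.
by rewrite nth_mkseq //; have := ple i ip; lia.
Qed.

Lemma gap2_nth p i : sorted (fun a b => b.+2 <= a) p -> i < size p ->
  last 0 p + ((size p).-1 - i).*2 <= nth 0 p i.
Proof.
elim: p i => [//|x [|y s] IH] i; first by case: i => //= _ _; lia.
move=> /[dup] /path_sorted {}/IH IH /= /andP[xy _].
case: i => [_|i ip]; last by have := IH i ip; rewrite /=; lia.
by have := IH 0 isT; rewrite /=; lia.
Qed.

(** On a nonincreasing sequence the distance is a plain difference, and dropping by at least 2 is
    transitive, so consecutive entries suffice. *)
Lemma gen_Rogers_RamanujanE l p : sorted geq p ->
  gen_Rogers_Ramanujan l p = all (ltn l) p && sorted (fun a b => b.+2 <= a) p.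
Proof.
move=> sp; congr (_ && _); apply/idP/idP.
  move=> /pairwise_sorted/(sortedP 0) gap; apply/(sortedP 0) => i ip.
  by have := gap i ip; have := (sortedP 0 sp) i ip; rewrite /=; lia.
rewrite sorted_pairwise; last by move=> a b c; lia.
by apply: sub_pairwise => a b; lia.
Qed.

Lemma part_rankE m p : sorted geq p ->
  (part_rank p == m%:Z - 1)%R = (head 0 p + 1 == m + size p).
Proof. by move=> sp; rewrite /part_rank largest_part_head //; lia. Qed.

Lemma num_R_staircase l m N : 0 < N ->
  #|[set p : intpart N | wide_conjugate l m p]| = num_R l (m%:Z - 1)%R N.
Proof.
move=> N0; apply/eqP; rewrite eqn_leq; apply/andP; split.
  apply: (@leq_card_intpart N _ (fun p => gen_Rogers_Ramanujan l p &&
    (part_rank p == m%:Z - 1)%R) add_staircase sub_staircase).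
  move=> p pN /andP[/eqP hp lp]; have /and3P[sp _ /eqP sumN] := pN.
  have p0 := intpart_size_gt0 N0 pN.
  have ple i : i < size p -> size p + l <= nth 0 p i.
    move=> ip; apply: leq_trans lp _; rewrite -nth_last.
    by apply: sorted_geq_nth => //; lia.
  have ple0 i : i < size p -> size p <= nth 0 p i.
    by move=> /ple; apply: leq_trans (leq_addr _ _).
  have gap : sorted (fun a b => b.+2 <= a) (add_staircase p).
    apply/(sortedP 0) => i; rewrite size_mkseq => ip.
    rewrite !nth_mkseq //; last exact: ltnW.
    by have := sorted_geq_nth sp (leqnSn i); have := ple _ ip; lia.
  (* The extreme case is the last entry, which loses [(size p).-1] from a value of at least
     [size p + l]. *)
  have big : all (ltn l) (add_staircase p).
    apply/(all_nthP 0) => i; rewrite size_mkseq => ip; rewrite nth_mkseq //=.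
    by have := ple _ ip; lia.
  have sa : sorted geq (add_staircase p).
    by apply: sub_sorted gap => a b /=; lia.
  rewrite gen_Rogers_RamanujanE // part_rankE // gap big add_staircaseK //.
  rewrite /is_intpart sa sumn_add_staircase // sumN eqxx andbT.
  rewrite -nth0 nth_mkseq // size_mkseq nth0 hp; split=> //; last lia.
  by apply: sub_all big => i /=; lia.
apply: (@leq_card_intpart N (fun p => gen_Rogers_Ramanujan l p &&
  (part_rank p == m%:Z - 1)%R) _ sub_staircase add_staircase).
move=> p pN; have /and3P[sp _ /eqP sumN] := pN.
have p0 := intpart_size_gt0 N0 pN.
rewrite gen_Rogers_RamanujanE // part_rankE // => /andP[/andP[big gap] /eqP rk].
have lastp : l < last 0 p.
  by rewrite -nth_last; apply: (allP big); rewrite mem_nth // ltn_predL.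
(* The smallest part is at least [l + 1], and each of the [(size p).-1 - i] gaps after position [i]
   adds at least 2. *)
have ple i : i < size p -> l + ((size p).-1).*2 < nth 0 p i + i.*2.
  by move=> ip; have := gap2_nth gap ip; lia.
have K : add_staircase (sub_staircase p) = p.
  by apply: sub_staircaseK => i /ple; lia.
have dle i : i < size p -> size p + l <= nth 0 (sub_staircase p) i.
  by move=> ip; rewrite nth_mkseq //; have := ple i ip; lia.
(* By [K], sum preservation for [add_staircase] applies backwards, with [dle] providing its lower
   bound. *)
have sumd : sumn (sub_staircase p) = N.
  rewrite -sumn_add_staircase ?K // size_mkseq => i /dle.
  by apply: leq_trans (leq_addr _ _).
have lt_last : (size p).-1 < size p by rewrite ltn_predL.
split=> //; last first.
  rewrite /wide_conjugate -nth_last size_mkseq dle // andbT.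
  by rewrite -nth0 nth_mkseq // nth0; lia.
rewrite /is_intpart sumd eqxx andbT; apply/andP; split.
  (* Removing the staircase shrinks each consecutive gap by exactly 2, which leaves it
     nonnegative. *)
  apply/(sortedP 0) => i; rewrite size_mkseq => ip.
  rewrite /= !nth_mkseq //; last exact: ltnW.
  by have := (sortedP 0 gap) i ip; lia.
apply/(all_nthP 0) => i; rewrite size_mkseq => ip.
by have := dle i ip; lia.
Qed.

Unset Implicit Arguments.

Theorem theorem4p2 (l m N : nat) (hN : 1 <= N) :
  num_L l m N = num_R l (m%:Z - 1)%R N.
Proof. by rewrite num_L_conjugate // num_R_staircase. Qed.
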